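(* Consider the system of ODEs $$\dot X_1=f(\boldsymbol u)+g_1(\boldsymbol X;\boldsymbol p_1),\qquad \dot X_i=g_i(\boldsymbol X;\boldsymbol p_i),\quad i=2,\dots,n,$$ where $\boldsymbol X=(X_1,\dots,X_n)$ is fully observed, $\boldsymbol u\subseteq\boldsymbol X$ is a subset of the state variables, $f$ is an unknown real-valued function, the $g_i$ are known functional forms depending on sets $\boldsymbol p_i$ of unknown parameters, and $|\boldsymbol p_1|>0$. Suppose that $g_1$ can be decomposed as $$g_1(\boldsymbol X;\boldsymbol p_1)=r(\boldsymbol v;\boldsymbol a)+s(\boldsymbol X;\boldsymbol b),\qquad \boldsymbol p_1=\{\boldsymbol a,\boldsymbol b\},$$ where $\boldsymbol v\subseteq\boldsymbol u$, $\boldsymbol a\cap\boldsymbol b=\emptyset$, $\boldsymbol a\cap\boldsymbol p_i=\emptyset$ for all $i>1$, and $|\boldsymbol a|>0$. Then $f$ is structurally non-identifiable. Specifically, given any admissible pair $(f_1,\{\boldsymbol a_1,\boldsymbol b\})$, any pair $(f_2,\{\boldsymbol a_2,\boldsymbol b\})$ of the form $$\boldsymbol a_2\in\mathbb{R}^{|\boldsymbol a|},\qquad f_2(\boldsymbol u)=f_1(\boldsymbol u)+r(\boldsymbol v;\boldsymbol a_1)-r(\boldsymbol v;\boldsymbol a_2),$$ yields identical dynamics to $(f_1,\{\boldsymbol a_1,\boldsymbol b\})$.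
   Context: An ODE model has the form $\dot{\boldsymbol X}(t)=\boldsymbol F(\boldsymbol X;\boldsymbol f,\boldsymbol p)$, $\boldsymbol Y(t)=\boldsymbol H(\boldsymbol X(t))$, with state $\boldsymbol X\in\mathbb{R}^n$, observed output $\boldsymbol Y$ consisting of some or all of the state variables, known $\boldsymbol F,\boldsymbol H$, unknown scalar parameters $\boldsymbol p$, and unknown real-valued functions $\boldsymbol f=(f_1,\dots,f_k)$, where $f_j:\mathcal U_j\to\mathbb{R}$ depends on a subset of the state variables. $|\cdot|$ denotes the number of parameters in a parameter set. A choice of unknowns is admissible if it is a possible choice of functions and parameters for the model. Here all state variables are observed: $\boldsymbol Y=\boldsymbol X$. Parameters not in $\boldsymbol a$ are the same for the two choices. Two choices $(\boldsymbol f_1,\boldsymbol p_1)$ and $(\boldsymbol f_2,\boldsymbol p_2)$ give the same observed outputs (''yield identical dynamics'') if they produce the same output trajectory $\boldsymbol Y(t)$ for every initial condition consistent with prior knowledge of the initial conditions (here: $\boldsymbol Y(0)$ is known). Fix a generic choice $(\boldsymbol f_1,\boldsymbol p_1)$. An unknown function $f_j$ is globally structurally identifiable (or simply structurally identifiable) if every choice $(\boldsymbol f_2,\boldsymbol p_2)$ giving the same observed outputs as $(\boldsymbol f_1,\boldsymbol p_1)$ has $f_{1,j}=f_{2,j}$; locally structurally identifiable if there is $\varepsilon>0$ such that every choice giving the same observed outputs and satisfying $\sup_{\boldsymbol u\in\mathcal U_j}|f_{1,j}(\boldsymbol u)-f_{2,j}(\boldsymbol u)|<\varepsilon$ has $f_{1,j}=f_{2,j}$;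 structurally non-identifiable otherwise.
   Formalization: Non-identifiability of f is proved assuming that, on a connected set of values of a containing a_1, r(.;a) varies continuously in the sup norm on the domain of f and is not constant in a, and the pairs (f_2,{a_2,b}) are admissible; without this it can fail (r constant in a; r=ax on R). *)

(* Defs.v *)
From HB Require Import structures.
From mathcomp Require Import all_boot all_order all_algebra.
From mathcomp Require Import all_classical all_reals all_analysis.
Set Implicit Arguments.
Unset Strict Implicit.
Unset Printing Implicit Defensive.
Import Order.TTheory GRing.Theory Num.Theory.
Import numFieldNormedType.Exports.
Local Open Scope classical_set_scope.
Local Open Scope ring_scope.

Section Subvectors.
Context {R : realType} {m : nat}.
Implicit Types (A B : {set 'I_m}) (x : 'rV[R]_m).

(* A subset of the coordinates (of the state, or of the parameters) is a
   {set 'I_m}; the coordinates in A are listed in increasing order of index. *)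
Definition subvec A x : 'rV[R]_#|A| := \row_k x ord0 (enum_val k).

Definition overwrite {A} x (w : 'rV[R]_#|A|) : 'rV[R]_m :=
  \row_i (if [pick k | enum_val k == i] is Some k then w ord0 k else x ord0 i).

(* For B \subset A, the coordinates in B of a vector indexed by A; the padding
   by 0 is then never read, see subsubvec_subvec. *)
Definition subsubvec {A} B (w : 'rV[R]_#|A|) : 'rV[R]_#|B| :=
  subvec B (overwrite 0 w).

Lemma subvec_overwrite A x (w : 'rV[R]_#|A|) : subvec A (overwrite x w) = w.
Proof.
apply/rowP => k; rewrite !mxE; case: pickP => [l /eqP/enum_val_inj -> //|].
by move/(_ k); rewrite eqxx.
Qed.

Lemma overwrite_out A x (w : 'rV[R]_#|A|) i : i \notin A -> overwrite x w ord0 i = x ord0 i.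
Proof.
move=> iA; rewrite mxE; case: pickP => // k /eqP ki.
by move: iA; rewrite -ki (enum_valP k).
Qed.

Lemma overwrite_in A x y i :
  i \in A -> overwrite x (subvec A y) ord0 i = y ord0 i.
Proof.
move=> iA; rewrite mxE; case: pickP => [k /eqP ki|]; first by rewrite mxE ki.
by move/(_ (enum_rank_in iA i)); rewrite enum_rankK_in ?eqxx.
Qed.

Lemma subvec_overwrite_disjoint A B x (w : 'rV[R]_#|A|) :
  [disjoint A & B]%B -> subvec B (overwrite x w) = subvec B x.
Proof.
move=> dAB; apply/rowP => k; rewrite [LHS]mxE overwrite_out ?[RHS]mxE //.
by rewrite (disjointFl dAB) ?enum_valP.
Qed.

Lemma subsubvec_subvec A B x :
  B \subset A -> subsubvec B (subvec A x) = subvec B x.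
Proof.
move=> /fintype.subsetP BA; apply/rowP => k; rewrite [LHS]mxE overwrite_in ?[RHS]mxE //.
exact/BA/enum_valP.
Qed.

End Subvectors.

(* A choice (f, p) of unknowns: functions f_j : U_j -> R and a parameter vector. *)
Definition choice_of (R : realType) (n k N : nat) (args : 'I_k -> {set 'I_n})
    (dom : forall j, set 'rV[R]_#|args j|) : Type :=
  ((forall j, dom j -> R) * 'rV[R]_N)%type.

(* dX/dt = F(X; f, p), Y = some or all of the coordinates of X.
   [rhs x y p] is the value of F at the state x when y is the vector of the
   values f_j(u_j), where u_j is the subvector of x on which f_j depends.
   [init] is the set of initial states consistent with prior knowledge. *)
Record ode_model (R : realType) := OdeModel {
  nstate : nat;
  nfun : nat;
  nparam : nat;
  rhs : 'rV[R]_nstate -> 'rV[R]_nfun -> 'rV[R]_nparam -> 'rV[R]_nstate;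
  observed : {set 'I_nstate};
  fargs : 'I_nfun -> {set 'I_nstate};
  fdom : forall j, set 'rV[R]_#|fargs j|;
  init : set 'rV[R]_nstate;
  admissible : set (choice_of nparam fdom)
}.
Arguments fdom {R} M j : rename.
Arguments choice_of {R n k} N {args} dom.

Section Identifiability.
Context {R : realType} (M : ode_model R).
Local Notation choice := (choice_of (nparam M) (fdom M)).
Local Notation state := 'rV[R]_(nstate M).
Implicit Types (c : choice) (x : state) (T : \bar R) (j : 'I_(nfun M)).

Definition horizon T : set R := [set t | 0 <= t /\ (t%:E < T)%E].

(* The derivative at time t is F(X(t); f, p); in particular every u_j(X(t)) has
   to lie in the domain U_j of f_j. *)
Definition satisfies_ode c (X : R -> state) (t : R) : Prop :=
  exists w : forall j, fdom M j,
    (forall j, \val (w j) = subvec (fargs j) (X t)) /\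
    forall i, is_derive t 1 (fun s => X s ord0 i)
                (rhs (X t) (\row_j c.1 j (w j)) c.2 ord0 i).

(* Solutions on [0, T): continuous there, with the equation on (0, T). *)
Definition solution c x0 T (X : R -> state) : Prop :=
  [/\ X 0 = x0,
      forall i, {within horizon T, continuous (fun t => X t ord0 i)},
      forall t, horizon T t -> forall j, fdom M j (subvec (fargs j) (X t)) &
      forall t, 0 < t -> (t%:E < T)%E -> satisfies_ode c X t].

Definition outputs c x0 T : set (R -> 'rV[R]_#|observed M|) :=
  [set Y | exists2 X, solution c x0 T X &
           forall t, horizon T t -> Y t = subvec (observed M) (X t)].

(* Sets of output trajectories are compared, on every time interval [0, T), so
   that existence and uniqueness of solutions need not be assumed. *)
Definition same_outputs c1 c2 : Prop :=
  forall x0, init x0 -> forall T, (0 < T)%E -> outputs c1 x0 T = outputs c2 x0 T.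

Definition globally_identifiable c1 j : Prop :=
  forall c2, admissible c2 -> same_outputs c1 c2 -> c1.1 j = c2.1 j.

Definition locally_identifiable c1 j : Prop :=
  exists2 eps : R, 0 < eps &
    forall c2, admissible c2 -> same_outputs c1 c2 ->
      (ereal_sup (range (fun u : fdom M j => `|c1.1 j u - c2.1 j u|%:E)) < eps%:E)%E ->
      c1.1 j = c2.1 j.

Definition nonidentifiable c1 j : Prop :=
  ~ globally_identifiable c1 j /\ ~ locally_identifiable c1 j.

End Identifiability.

Section SingleUnknownFunction.
Context {R : realType} {n N : nat} (u : {set 'I_n.+1}) (U : set 'rV[R]_#|u|).

Definition choice1 : Type := choice_of N (args := fun _ : 'I_1 => u) (fun=> U).

Definition mk_choice (f : U -> R) (p : 'rV[R]_N) : choice1 := (fun=> f, p).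

(* dX_1/dt = f(u) + g_1(X; p_1), dX_i/dt = g_i(X; p_i) for i >= 2, Y = X.
   The state is (X_1, ..., X_{n+1}), X_1 having index ord0, and [ps i] is the set
   p_i of parameters, a subset of the N unknown parameters of the model. *)
Definition single_model (ps : 'I_n.+1 -> {set 'I_N})
    (g : forall i, 'rV[R]_n.+1 -> 'rV[R]_#|ps i| -> R)
    (init : set 'rV[R]_n.+1) (adm : set choice1) : ode_model R :=
  @OdeModel R n.+1 1 N
    (fun x y p => \row_i ((if i == ord0 then y ord0 ord0 else 0)
                          + g i x (subvec (ps i) p)))
    [set: 'I_n.+1] (fun=> u) (fun=> U) init adm.

End SingleUnknownFunction.
Arguments mk_choice {R n N u U} f p.

(* Main.v *)
(* Two choices with the same right-hand side have the same solutions. For the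
   nonidentifiability, the functions [rU al] with [al] in [A] form a connected
   set with at least two points in the Hausdorff space of functions on [U] with
   the uniform topology, so [rU (subvec a p1)] is a limit point of it: there are
   reparametrizations uniformly arbitrarily close to [f1], but distinct from it. *)

Require Import Defs.
From HB Require Import structures.
From mathcomp Require Import all_boot all_order all_algebra.
From mathcomp Require Import all_classical all_reals all_analysis.
Import Order.TTheory GRing.Theory Num.Theory.
Import numFieldNormedType.Exports.
Local Open Scope classical_set_scope.
Local Open Scope ring_scope.

(** If [x] were not a limit point, some neighbourhood would cut [K] down to [[set x]], making the
    singleton relatively open. It is also closed, so connectedness would give [K] = [[set x]],
    against [y]. *)
Lemma connected_limit_point {T : topologicalType} {K : set T} {x : T} (y : T) :
  accessible_space T -> connected K -> K x -> K y -> x <> y -> limit_point K x.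
Proof.
move=> accT cK Kx Ky xy; apply: contrapT; rewrite not_limit_pointE.
case=> V xV KVx; suff Kx1 : [set x] = K by move: Ky; rewrite -Kx1 => /esym.
apply: cK; first by exists x.
- exists (interior V); first exact: open_interior.
  apply/seteqP; split=> [z ->|z [Kz Vz]]; first by split=> //; exact: xV.
  by apply: KVx; split=> //; exact: interior_subset.
- exists [set x]; first exact: accessible_closed_set1.
  by apply/seteqP; split=> [z ->|z []].
Qed.

(** Functions that no uniform neighbourhoods separate have inseparable values at every point, and
    [V] separates distinct values. *)
Lemma hausdorff_uniform_fun {S : choiceType} {V : uniformType} :
  hausdorff_space V -> hausdorff_space {uniform S -> V}.
Proof.
move=> hV f g; rewrite -closeEnbhs hausdorrf_close_eq_in// => fg.
by apply/funext => w; apply: fg; rewrite inE.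
Qed.

Lemma connected_uniform_approx {R : realType} {S : choiceType}
    {T : topologicalType} {h : T -> {uniform S -> R}} {A : set T} {t : T}
    {eps : R} :
  connected A -> {within A, continuous h} ->
  (exists t1 t2, [/\ A t1, A t2 & h t1 <> h t2]) ->
  A t -> 0 < eps ->
  exists t', [/\ A t', h t' <> h t & forall w, `|h t w - h t' w| < eps].
Proof.
move=> cA hc [t1 [t2 [At1 At2 h12]]] At eps0.
(* Since [h t1] and [h t2] differ, at least one of them differs from [h t]. *)
have [t3 At3 ht3] : exists2 t3, A t3 & h t <> h t3.
  have [htt1|?] := pselect (h t = h t1); last by exists t1.
  by exists t2 => //; rewrite htt1.
have acc : accessible_space {uniform S -> R}.
  exact/hausdorff_accessible/hausdorff_uniform_fun/Rhausdorff.
have lim : limit_point (h @` A) (h t).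
  apply: (connected_limit_point (h t3)) => //.
  exact: connected_continuous_connected.
(* The [eps]-tube around [h t] is a uniform neighbourhood, so it contains another point of the image
   of [A]. *)
have [|k [/eqP kt [t' At' t'k] near]] :=
    lim [set k | forall w, `|h t w - k w| < eps].
  apply/uniform_nbhs; exists [set xy | ball xy.1 eps xy.2]; split.
    exact: entourage_ball (PosNum eps0).
  by move=> k hk w; exact: hk.
by exists t'; rewrite t'k.
Qed.

Section OdeModel.
Context {R : realType} (M : ode_model R).
Local Notation choice := (choice_of (nparam M) (fdom M)).

(** Only states whose subvectors lie in the domains are compared: [satisfies_ode] evaluates the
    right-hand side at no others. *)
Definition same_rhs (c1 c2 : choice) : Prop :=
  forall (x : 'rV[R]_(nstate M)) (w : forall j, fdom M j),
    (forall j, \val (w j) = subvec (fargs j) x) ->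
    rhs x (\row_j c1.1 j (w j)) c1.2 = rhs x (\row_j c2.1 j (w j)) c2.2.

Lemma same_rhs_sym (c1 c2 : choice) : same_rhs c1 c2 -> same_rhs c2 c1.
Proof. by move=> c12 x w xw; rewrite c12. Qed.

Lemma same_rhs_sub_outputs (c1 c2 : choice) x0 T :
  same_rhs c1 c2 -> outputs c1 x0 T `<=` outputs c2 x0 T.
Proof.
move=> c12 Y [X [X0 Xc Xdom Xode] YX]; exists X => //; split=> // t t0 tT.
have [w [wX wder]] := Xode t t0 tT.
by exists w; split=> // i; rewrite -c12.
Qed.

Lemma same_rhs_outputs (c1 c2 : choice) : same_rhs c1 c2 -> same_outputs c1 c2.
Proof.
move=> c12 x0 _ T _; apply/seteqP.
by split; apply: same_rhs_sub_outputs => //; exact: same_rhs_sym.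
Qed.

Lemma globally_locally_identifiable (c : choice) j :
  globally_identifiable c j -> locally_identifiable c j.
Proof. by move=> gc; exists 1 => // c2 adm2 cc2 _; exact: gc. Qed.

(** Refuting local identifiability is enough, since global identifiability implies it. *)
Lemma nonidentifiable_approx (c : choice) j :
  (forall eps : R, 0 < eps -> exists c2 : choice,
     [/\ admissible c2, same_outputs c c2, c2.1 j <> c.1 j &
         forall w, `|c.1 j w - c2.1 j w| < eps]) ->
  nonidentifiable c j.
Proof.
move=> H; have nloc : ~ locally_identifiable c j.
  move=> [eps eps0 loc].
  (* Pointwise strict bounds give only a weak bound on the supremum; [eps / 2] keeps it strictly
     below [eps]. *)
  have [c2 [adm2 same2 neq le2]] := H _ (divr_gt0 eps0 (ltr0Sn R 1)).
  apply/neq/esym/loc => //.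
  apply: (@le_lt_trans _ _ (eps / 2)%:E).
    by apply: ge_ereal_sup => _ [w _ <-]; rewrite lee_fin ltW.
  by rewrite lte_fin ltr_pdivrMr// ltr_pMr// ltr1n.
by split=> // /globally_locally_identifiable.
Qed.

End OdeModel.

(** [A] is a range of values of the parameters [a] within which [adm] is closed under
    reparametrization. Were the functions [rU al] isolated from each other, [f1] could be locally
    identifiable; connectedness of [A] and continuity for the uniform topology, the one that
    measures locality, exclude this. *)
Theorem proposition3p2 (R : realType) (n N : nat)
    (u v : {set 'I_n.+1}) (U : set 'rV[R]_#|u|)
    (ps : 'I_n.+1 -> {set 'I_N})
    (g : forall i, 'rV[R]_n.+1 -> 'rV[R]_#|ps i| -> R)
    (init : set 'rV[R]_n.+1) (adm : set (choice1 (N := N) U))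
    (a b : {set 'I_N})
    (r : 'rV[R]_#|v| -> 'rV[R]_#|a| -> R)
    (s : 'rV[R]_n.+1 -> 'rV[R]_#|b| -> R)
    (p1_nonempty : (0 < #|ps ord0|)%N)
    (g1_split : forall (x : 'rV[R]_n.+1) (p : 'rV[R]_N),
       g ord0 x (subvec (ps ord0) p)
       = r (subvec v x) (subvec a p) + s x (subvec b p))
    (p1_split : ps ord0 = a :|: b)
    (v_sub_u : v \subset u)
    (a_disj_b : [disjoint a & b]%B)
    (a_disj_ps : forall i, i != ord0 -> [disjoint a & ps i]%B)
    (a_nonempty : (0 < #|a|)%N) :
  let M := single_model g init adm in
  (* r(v; a) as a function of u in U *)
  let rU := fun (al : 'rV[R]_#|a|) (w : U) => r (subsubvec v (\val w)) al in
  let reparam := fun (f1 : U -> R) (a1 a2 : 'rV[R]_#|a|) (w : U) =>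
    f1 w + rU a1 w - rU a2 w in
  (forall A : set 'rV[R]_#|a|,
     connected A ->
     {within A, continuous (rU : 'rV[R]_#|a| -> {uniform U -> R})} ->
     (exists a1 a2, [/\ A a1, A a2 & rU a1 <> rU a2]) ->
     (forall f1 p1 a2, adm (mk_choice f1 p1) -> A (subvec a p1) -> A a2 ->
        adm (mk_choice (reparam f1 (subvec a p1) a2) (overwrite p1 a2))) ->
     forall f1 p1, adm (mk_choice f1 p1) -> A (subvec a p1) ->
       nonidentifiable (M := M) (mk_choice f1 p1) ord0)
  /\
  (forall f1 p1, adm (mk_choice f1 p1) ->
     forall a2 : 'rV[R]_#|a|,
       same_outputs (M := M) (mk_choice f1 p1)
         (mk_choice (reparam f1 (subvec a p1) a2) (overwrite p1 a2))).
Proof.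
move=> M rU reparam.
have same f1 p1 (a2 : 'rV[R]_#|a|) : same_outputs (M := M) (mk_choice f1 p1)
    (mk_choice (reparam f1 (subvec a p1) a2) (overwrite p1 a2)).
  apply: same_rhs_outputs => x w xw; apply/rowP => i; rewrite !mxE /=.
  (* Equations other than the first do not see [a], so overwriting it leaves them unchanged. *)
  have [->|i0] := eqVneq i ord0; last first.
    by rewrite subvec_overwrite_disjoint ?a_disj_ps.
  (* In the first equation [s] sees only [b], which is kept, and the term [r] at [a2] cancels the
     one subtracted in [reparam]. As [v] lies in [u], both read the same coordinates of the
     state. *)
  rewrite !g1_split subvec_overwrite subvec_overwrite_disjoint// /reparam /rU.
  by rewrite xw subsubvec_subvec// [RHS]addrA subrK addrA.
split=> [A cA rUc rUneq admA f1 p1 adm1 Ap1|f1 p1 _ a2]; last exact: same.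
apply: nonidentifiable_approx => eps eps0.
have [a2 [Aa2 neq near]] := connected_uniform_approx cA rUc rUneq Ap1 eps0.
exists (mk_choice (reparam f1 (subvec a p1) a2) (overwrite p1 a2)).
split=> [|||w]; [exact: admA|exact: same| |].
(* The new function minus [f1] is [rU (subvec a p1)] minus [rU a2], so both distinctness and
   closeness carry over from [rU]. *)
- move=> /= eqf; apply/neq/funext => w.
  have := congr1 (fun f => f w) eqf; rewrite /reparam /= => /eqP.
  by rewrite -addrA eq_sym -subr_eq0 opprD addNKr oppr_eq0 subr_eq0 => /eqP.
- by rewrite /= /reparam -addrA opprD addNKr normrN; exact: near.
Qed.
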